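(* Let $p$ be a prime and $n \ge 1$ an integer. Then the unital compressed commuting graph, respectively the compressed commuting graph, of the field $GF(p^n)$ is a complete graph on $d(n)$, respectively $d(n)+1$, vertices with all the loops, i.e. $$\Lambda^1(GF(p^n)) \cong K_{d(n)}^\circ \quad\text{ and }\quad \Lambda(GF(p^n)) \cong K_{d(n)+1}^\circ.$$
   Context: $GF(p^n)$ is the finite field with $p^n$ elements; $d(n)$ is the number of positive divisors of $n$; $K_m^\circ$ is the complete graph on $m$ vertices with a loop at every vertex. For a ring $R$ and $a\in R$, let $\langle a \rangle = \{q(a) \mid q \in \mathbb{Z}[x],\ q(0)=0\}$ be the (not necessarily unital) subring generated by $a$, and, if $R$ is unital, let $\langle a\rangle_1=\{q(a)\mid q\in\mathbb{Z}[x]\}$ be the unital subring generated by $a$. The compressed commuting graph $\Lambda(R)$ is the undirected graph with vertex set $\{\langle a\rangle \mid a\in R\}$, in which $\langle a\rangle$ and $\langle b\rangle$ are joined by an edge (a loop if they are equal) iff $ab=ba$. The unital compressed commuting graph $\Lambda^1(R)$ of a unital ring $R$ is the undirected graph with vertex set $\{\langle a\rangle_1 \mid a\in R\}$, in which $\langle a\rangle_1$ and $\langle b\rangle_1$ are joined by an edge (a loop if they are equal) iff $ab=ba$. *)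

(* Defs.v *)
From HB Require Import structures.
From mathcomp Require Import all_boot all_order all_algebra all_field.
From mathcomp Require Import boolp classical_sets.
Set Implicit Arguments.
Unset Strict Implicit.
Unset Printing Implicit Defensive.
Import GRing.Theory.
Local Open Scope ring_scope.
Local Open Scope classical_set_scope.

(* Undirected graphs, possibly infinite, with at most one edge between two
   vertices; a loop at x is an edge from x to x. *)
Record graph := Graph {
  vertex : Type;
  edge : vertex -> vertex -> Prop;
  edge_sym : forall x y, edge x y -> edge y x
}.

Definition graph_iso (G H : graph) : Prop :=
  exists2 f : vertex G -> vertex H,
    bijective f & forall x y, edge x y <-> edge (f x) (f y).

Definition looped_complete_graph (m : nat) : graph :=
  @Graph 'I_m (fun _ _ => True) (fun _ _ _ => I).

Section CompressedCommutingGraphs.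
Variable R : nzRingType.
Implicit Types (a b : R) (q : {poly int}).

Definition int_poly_eval q a : R := (map_poly intr q).[a].

Definition gen_subring a : set R :=
  [set int_poly_eval q a | q in [set q : {poly int} | q.[0] = 0]].

Definition gen_subring1 a : set R :=
  [set int_poly_eval q a | q in [set: {poly int}]].

Section Compression.
Variable gen : R -> set R.

(* The edge relation does not depend on the choice of the generators: see
   edge_compressed_commuting_graph and its unital analogue below. *)
Definition commuting_edge (S T : set_type (range gen)) : Prop :=
  exists a b, [/\ \val S = gen a, \val T = gen b & a * b = b * a].

Lemma commuting_edge_sym S T : commuting_edge S T -> commuting_edge T S.
Proof. by move=> [a [b [Sa Tb ab]]]; exists b, a. Qed.

Definition compression_graph : graph := Graph commuting_edge_sym.

End Compression.

Definition compressed_commuting_graph : graph := compression_graph gen_subring.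

Definition unital_compressed_commuting_graph : graph :=
  compression_graph gen_subring1.

Lemma comm_int_poly_eval a b q :
  GRing.comm a b -> GRing.comm a (int_poly_eval q b).
Proof.
move=> ab; rewrite /int_poly_eval horner_coef; apply: commr_sum => i _.
by rewrite coef_map /=; apply: commrM; [exact: commr_int | exact: commrX].
Qed.

Lemma edge_compressionE (gen : R -> set R) :
    (forall a, gen a a) -> (forall a b, gen a b -> exists q, int_poly_eval q a = b) ->
  forall (S T : vertex (compression_graph gen)) a b,
    \val S = gen a -> \val T = gen b -> edge S T <-> a * b = b * a.
Proof.
move=> gen_id genP S T a b Sa Tb; split=> [[a' [b' [Sa' Tb' ab']]]|]; last first.
  by move=> ab; exists a, b.
have /genP[q <-] : gen a' a by rewrite -Sa' Sa.
have /genP[r <-] : gen b' b by rewrite -Tb' Tb.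
apply: comm_int_poly_eval; apply/commr_sym.
by apply: comm_int_poly_eval; apply/commr_sym.
Qed.

Lemma edge_compressed_commuting_graph
    (S T : vertex compressed_commuting_graph) a b :
    \val S = gen_subring a -> \val T = gen_subring b ->
  edge S T <-> a * b = b * a.
Proof.
apply: edge_compressionE => [c|c d [q _ <-]]; last by exists q.
by exists 'X; rewrite /= ?hornerX // /int_poly_eval map_polyX hornerX.
Qed.

Lemma edge_unital_compressed_commuting_graph
    (S T : vertex unital_compressed_commuting_graph) a b :
    \val S = gen_subring1 a -> \val T = gen_subring1 b ->
  edge S T <-> a * b = b * a.
Proof.
apply: edge_compressionE => [c|c d [q _ <-]]; last by exists q.
by exists 'X; rewrite // /int_poly_eval map_polyX hornerX.
Qed.

End CompressedCommutingGraphs.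

(* Main.v *)
(* The unital subrings of GF(p^n) are the sets of fixed points of the d-th power
   of Frobenius for d dividing n: such a subring S has p^k elements by Lagrange
   in the additive group, its nonzero elements form a group of order p^k - 1, so
   that S consists of roots of X^(p^k) - X and, by cardinality, of all of them.
   Each of these subrings is generated by one element, a generator of its cyclic
   multiplicative group. Finally a nonzero a satisfies a^(p^n - 1) = 1, so <a>
   contains 1 and equals <a>_1; the only further vertex of the non-unital graph is
   <0> = {0}. A subring is thus determined by its cardinality, which labels the
   vertices. *)
Require Import Defs.
From mathcomp Require Import all_boot all_order all_algebra all_field.
From mathcomp Require Import all_fingroup all_solvable boolp classical_sets.
Set Implicit Arguments.
Unset Strict Implicit.
Unset Printing Implicit Defensive.
Import GRing.Theory.

(** * Arithmetic and graph preliminaries *)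

Lemma dvdn_exp_predX p d k :
  (1 < p)%N -> ((p ^ d).-1 %| (p ^ k).-1)%N -> (d %| k)%N.
Proof.
move=> p_gt1; have p_gt0 : (0 < p)%N := ltnW p_gt1.
case: (posnP d) => [->|d_gt0].
  by rewrite dvd0n dvd0n -eqSS prednK ?expn_gt0 ?p_gt0// -[1%N](expn0 p) eqn_exp2l.
(* Write k = qd + r with r < d. Since p^d - 1 divides p^(qd) - 1, it divides p^r - 1 < p^d - 1 as
   well, which forces r = 0. *)
have -> : (p ^ k).-1 = ((p ^ (k %/ d * d)).-1 * p ^ (k %% d) + (p ^ (k %% d)).-1)%N.
  rewrite {1}(divn_eq k d) expnD -!subn1 mulnBl mul1n addnBA ?expn_gt0 ?p_gt0//.
  by rewrite subnK// leq_pmull// expn_gt0 p_gt0.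
rewrite mulnC expnM dvdn_addr; last first.
  by rewrite dvdn_mull// -expnM mulnC expnM dvdn_pred_predX.
move=> /dvdn_leq; rewrite -subn1 subn_gt0.
rewrite -{1}(expn0 p) ltn_exp2l// => /implyP.
have lt_pr : (p ^ (k %% d) < p ^ d)%N by rewrite ltn_exp2l// ltn_mod.
rewrite -subn1 leq_sub2rE ?expn_gt0 ?p_gt0// (leqNgt (p ^ d)) lt_pr implybF.
by rewrite lt0n negbK.
Qed.

(** A vertex is sent to the position of its label in [s]; the inverse map comes from choice. *)
Lemma graph_iso_looped_complete (G : graph) (T : eqType) (s : seq T)
    (f : vertex G -> T) :
  uniq s -> injective f -> (forall x, f x \in s) ->
  (forall t, t \in s -> exists x, f x = t) -> (forall x y : vertex G, edge x y) ->
  graph_iso G (looped_complete_graph (size s)).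
Proof.
move=> s_uniq f_inj fs sf complete.
have lt_fs x : (index (f x) s < size s)%N by rewrite index_mem.
have /choice[g fg] (i : 'I_(size s)) : exists x, f x = tnth (in_tuple s) i.
  exact/sf/mem_tnth.
exists (fun x => Ordinal (lt_fs x)) => //.
exists g => [x|i].
  by apply: f_inj; rewrite fg (tnth_nth (f x)) nth_index.
by apply: val_inj; rewrite /= fg (tnth_nth (f (g i))) index_uniq.
Qed.

(** * Subrings of a finite field *)

Section FiniteField.
Local Open Scope ring_scope.
Variables (p n : nat) (F : finFieldType).
Hypotheses (p_prime : prime p) (cardF : #|F| = (p ^ n)%N).
Implicit Types (a : F) (S : {set F}).

Let p_gt1 : (1 < p)%N := prime_gt1 p_prime.
Let p_gt0 : (0 < p)%N := prime_gt0 p_prime.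

Lemma card_finsubring S : subring_closed (mem S) ->
  exists k, [/\ (k %| n)%N, #|S| = (p ^ k)%N &
               S = [set x | x ^+ (p ^ k) == x]%SET].
Proof.
move=> [S1 SB SM].
have S0 : 0 \in S by rewrite -(subrr 1) SB.
have SD x y : x \in S -> y \in S -> x + y \in S.
  by move=> Sx Sy; rewrite -[y]opprK SB// -[- y]sub0r SB.
have addS : group_set S by apply/group_setP; split=> // x y; apply: SD.
have [k _ cardS] : exists2 k, (k <= n)%N & #|S| = (p ^ k)%N.
  apply/dvdn_pfactor => //; rewrite -cardF -cardsT.
  exact: (@cardSg _ [group of [set: F]] (group addS) (finset.subsetT _)).
(* The unit group is finite, so closure under products makes U a subgroup. *)
pose U := [set u : {unit F} | val u \in S].
have mulU : group_set U.
  apply/group_setP; split=> [|u v]; rewrite !inE//; exact: SM.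
have cardU : #|U| = (p ^ k).-1.
  rewrite -cardS (cardsD1 0 S) S0 /= -(card_imset _ val_inj).
  apply: eq_card => x; rewrite !inE; apply/imsetP/andP => [[u]|[x0 Sx]].
    by rewrite inE => Su ->; rewrite -unitfE (valP u).
  have xU : x \is a GRing.unit by rewrite unitfE.
  by exists (Sub x xU); rewrite ?inE ?SubK.
have pk_gt0 : (0 < p ^ k)%N by rewrite expn_gt0 p_gt0.
exists k; split=> //.
  (* Lagrange in the unit group: p^k - 1 divides p^n - 1, hence k divides n. *)
  apply: (dvdn_exp_predX p_gt1); rewrite -cardU -cardF -card_finField_unit.
  exact: (@cardSg _ [group of [set: {unit F}]] (group mulU) (finset.subsetT _)).
apply/eqP; rewrite eqEcard; apply/andP; split.
  apply/fintype.subsetP => x Sx; rewrite inE; have [->|x0] := eqVneq x 0.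
    by rewrite expr0n gtn_eqF.
  have xU : x \is a GRing.unit by rewrite unitfE.
  pose u : {unit F} := Sub x xU.
  have /(congr1 val) : (u ^+ #|U|)%g = 1%g.
    by apply: (@expg_cardG _ (group mulU)); rewrite inE.
  by rewrite FinRing.val_unitX /= cardU => xk; rewrite -(prednK pk_gt0) exprS xk mulr1.
(* A polynomial of degree p^k has at most p^k roots. *)
rewrite cardS; set T := [set x | _]%SET.
(* For k = 0 the polynomial X^(p^k) - X would be zero; this is excluded because S contains 0 and
   1. *)
have k_gt0 : (0 < k)%N.
  have : (1 < #|S|)%N by apply/card_gt1P; exists 0, 1; rewrite eq_sym oner_eq0.
  by rewrite cardS; case: (k).
have pk_gt1 : (1 < p ^ k)%N by rewrite -(expn0 p) ltn_exp2l.
have szP : size ('X^(p ^ k) - 'X : {poly F}) = (p ^ k).+1.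
  by rewrite size_polyDl ?size_polyXn// size_polyN size_polyX ltnS pk_gt1.
rewrite -ltnS -szP cardE; apply: max_poly_roots; rewrite ?enum_uniq//.
  by rewrite -size_poly_eq0 szP.
apply/allP => x; rewrite mem_enum inE => /eqP xk.
by rewrite rootE !hornerE xk subrr.
Qed.

(** * Vertices labelled by cardinality *)

Definition set_card (A : set F) : nat :=
  #|[set x : F | `[< A x >]]%SET|.

(** Multiplication in F is commutative, so all edges are present and only the labels matter. Keeping
    [gen] abstract serves both graphs. *)
Lemma compression_graph_iso (gen : F -> set F) (s : seq nat) :
  uniq s -> (forall a b, set_card (gen a) = set_card (gen b) -> gen a = gen b) ->
  (forall a, set_card (gen a) \in s) ->
  (forall t, t \in s -> exists a, set_card (gen a) = t) ->
  graph_iso (compression_graph gen) (looped_complete_graph (size s)).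
Proof.
move=> s_uniq gen_inj gens sgen.
have vertexP (x : vertex (compression_graph gen)) : exists a, \val x = gen a.
  by have /set_mem[a _ ax] := valP x; exists a.
pose f (x : vertex (compression_graph gen)) := set_card (\val x).
apply: (graph_iso_looped_complete (f := f)) => //; rewrite /f.
- move=> x y; have [a xa] := vertexP x; have [b yb] := vertexP y.
  by rewrite xa yb => /gen_inj ab; apply: val_inj; rewrite /= xa yb.
- by move=> x; have [a ->] := vertexP x.
- move=> t /sgen[a <-].
  have ga : gen a \in (range gen)%classic.
    by apply: mem_set; exists a.
  by exists (exist _ (gen a) ga).
- move=> x y; have [a xa] := vertexP x; have [b yb] := vertexP y.
  by exists a, b; rewrite mulrC.
Qed.

(** * Unital subrings generated by one element *)

Lemma gen_subring1_closed a : subring_closed (mem [set x | `[< gen_subring1 a x >]]%SET).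
Proof.
split=> [|x y|x y]; rewrite !inE.
- by exists 1 => //; rewrite /int_poly_eval rmorph1 hornerC.
- move=> [q _ <-] [r _ <-]; exists (q - r) => //.
  by rewrite /int_poly_eval rmorphB !hornerE.
- move=> [q _ <-] [r _ <-]; exists (q * r) => //.
  by rewrite /int_poly_eval rmorphM hornerM.
Qed.

Lemma gen_subring1P a :
  exists k, [/\ (k %| n)%N, set_card (gen_subring1 a) = (p ^ k)%N &
               gen_subring1 a = (fun x => x ^+ (p ^ k) = x)].
Proof.
have [k [kn cardS eqS]] := card_finsubring (gen_subring1_closed a).
exists k; split=> //.
apply/funext => x; apply/propext; have /setP/(_ x) := eqS; rewrite !inE => xS.
by split=> [/asboolP|/eqP]; [rewrite xS => /eqP|rewrite -xS => /asboolP].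
Qed.

Lemma gen_subring1_inj a b :
  set_card (gen_subring1 a) = set_card (gen_subring1 b) ->
  gen_subring1 a = gen_subring1 b.
Proof.
have [k [_ -> ->]] := gen_subring1P a; have [l [_ -> ->]] := gen_subring1P b.
by move=> ->.
Qed.

(** As p is the characteristic, the p^d-th power map is additive; for differences this is applied to
    (x - y) + y. *)
Lemma finfield_frobenius_fixed_closed d :
  subring_closed [pred x : F | x ^+ (p ^ d) == x].
Proof.
have pF : [pchar F].-nat (p ^ d)%N.
  by rewrite pnatX (eq_pnat _ (pcharf_eq (card_finPcharP cardF p_prime))) pnat_id.
split=> [|x y|x y]; rewrite !inE.
- by rewrite expr1n.
- move=> /eqP xd /eqP yd; apply/eqP/(addIr (y ^+ (p ^ d))).
  by rewrite -exprDn_pchar// subrK xd yd subrK.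
- by move=> /eqP xd /eqP yd; rewrite exprMn xd yd.
Qed.

(** S contains the integer multiples of 1, and Horner's scheme then keeps every q(a) in S. *)
Lemma gen_subring1_min a (S : {pred F}) : subring_closed S -> a \in S ->
  forall x, gen_subring1 a x -> x \in S.
Proof.
move=> [S1 SB SM] Sa x [q _ <-].
have S0 : 0 \in S by rewrite -(subrr 1) SB.
have SD y z : y \in S -> z \in S -> y + z \in S.
  by move=> Sy Sz; rewrite -[z]opprK SB// -[- z]sub0r SB.
have Sint (z : int) : z%:~R \in S.
  elim: z => [//|m Sm|m Sm]; first by rewrite -addn1 PoszD rmorphD SD.
  by rewrite -addn1 PoszD opprD rmorphB SB.
rewrite /int_poly_eval; elim/poly_ind: q => [|q c IH]; first by rewrite rmorph0 horner0.
rewrite rmorphD rmorphM /= map_polyX map_polyC !hornerE.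
by apply: SD; [exact: SM | exact: Sint].
Qed.

(** Take a of order p^d - 1 in the cyclic unit group. Cancelling a in a^(p^e) = a shows that it
    holds iff p^d - 1 divides p^e - 1, that is, iff d divides e. *)
Lemma finfield_exact_frobenius_period d : (d %| n)%N ->
  exists2 a : F, a != 0 & forall e, (a ^+ (p ^ e) == a) = (d %| e)%N.
Proof.
move=> dn.
have [u U] := cyclicP (field_unit_group_cyclic [group of [set: {unit F}]]).
have ou : #[u]%g = (p ^ n).-1 by rewrite orderE -U card_finField_unit cardF.
have frobv (v : {unit F}) e :
    (val v ^+ (p ^ e) == val v) = (#[v]%g %| (p ^ e).-1)%N.
  have v0 : val v != 0 by rewrite -unitfE (valP v).
  rewrite order_dvdn -val_eqE /= FinRing.val_unitX -[RHS](inj_eq (mulfI v0)) /=.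
  by rewrite -exprS mulr1 prednK// expn_gt0 p_gt0.
have pred_dvd k l : (k %| l)%N -> ((p ^ k).-1 %| (p ^ l).-1)%N.
  by move=> kl; rewrite -(divnK kl) mulnC expnM dvdn_pred_predX.
have /dvdnP[m mE] : ((p ^ d).-1 %| #[u]%g)%N by rewrite ou pred_dvd.
have m_gt0 : (0 < m)%N by move: (order_gt0 u); rewrite mE; case: (m).
set v := (u ^+ m)%g.
have ov : #[v]%g = (p ^ d).-1 by rewrite orderXdiv mE ?dvdn_mulr// mulKn.
have v0 : val v != 0 by rewrite -unitfE (valP v).
exists (val v) => // e; transitivity ((p ^ d).-1 %| (p ^ e).-1)%N; last first.
  by apply/idP/idP => [/(dvdn_exp_predX p_gt1)|/pred_dvd].
by rewrite -ov frobv.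
Qed.

(** An element of exact Frobenius period d works; being nonzero, it also serves the non-unital
    graph. *)
Lemma gen_subring1_surj d : (d %| n)%N ->
  exists2 a : F, a != 0 & set_card (gen_subring1 a) = (p ^ d)%N.
Proof.
move=> dn; have [a a0 aP] := finfield_exact_frobenius_period dn; exists a => //.
have [k [kn -> eqS]] := gen_subring1P a; congr (p ^ _)%N.
apply/eqP; rewrite eqn_dvd; apply/andP; split.
  (* Some b in GF(p^k) has period exactly k, and b lies in <a>_1, whose elements
     are all fixed by the d-th power of Frobenius. *)
  have [b _ bP] := finfield_exact_frobenius_period kn.
  rewrite -bP; apply: (@gen_subring1_min a _ (finfield_frobenius_fixed_closed d)).
    by rewrite inE aP.
  by rewrite eqS; apply/eqP; rewrite bP.
rewrite -aP; apply/eqP.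
suff : gen_subring1 a a by rewrite {1}eqS.
by exists 'X; rewrite // /int_poly_eval map_polyX hornerX.
Qed.

(** * Non-unital subrings and the final count *)

Lemma gen_subring_neq0 a : a != 0 -> gen_subring a = gen_subring1 a.
Proof.
move=> a0; apply/seteqP; split=> x [q q0 <-]; first by exists q.
have F1_gt0 : (0 < #|F|.-1)%N by rewrite -subn1 subn_gt0 finNzRing_gt1.
(* Replace the constant term c of q by c X^(#|F| - 1). *)
exists (q + q.[0]%:P * ('X^(#|F|.-1) - 1)).
  by rewrite /= !hornerE expr0n gtn_eqF// sub0r mulrN1 subrr.
have a1 : a ^+ #|F|.-1 = 1.
  by apply: (mulfI a0); rewrite -exprS prednK ?(ltnW (finNzRing_gt1 F))// expf_card mulr1.
rewrite /int_poly_eval rmorphD rmorphM rmorphB /= map_polyXn rmorph1 map_polyC.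
by rewrite !hornerE a1 subrr mulr0 addr0.
Qed.

Lemma set_card_gen_subring0 : set_card (gen_subring (0 : F)) = 1%N.
Proof.
rewrite /set_card -(cards1 (0 : F)); apply: eq_card => x; rewrite !inE.
apply/asboolP/eqP => [[q q0 <-]|->].
  rewrite /int_poly_eval -[0 in LHS](rmorph0 intr) horner_map /=.
  by move: q0 => /= ->.
by exists 0; rewrite /= ?horner0// /int_poly_eval rmorph0 horner0.
Qed.

End FiniteField.

Theorem theorem12 (p n : nat) (F : finFieldType)
    (p_prime : prime p) (n_ge1 : 1 <= n) (cardF : #|F| = p ^ n) :
  graph_iso (unital_compressed_commuting_graph F)
            (looped_complete_graph (size (divisors n)))
  /\ graph_iso (compressed_commuting_graph F)
               (looped_complete_graph (size (divisors n)).+1).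
Proof.
pose s := [seq (p ^ d)%N | d <- divisors n].
have p_gt1 := prime_gt1 p_prime.
have n_gt0 : (0 < n)%N := n_ge1.
have s_uniq : uniq s by rewrite map_inj_uniq ?divisors_uniq//; exact: expnI.
(* Divisors of n are positive, so the label 1 stays free for <0> = {0}. *)
have s1 : 1%N \notin [seq (p ^ d)%N | d <- divisors n].
  apply/mapP => -[d]; rewrite -dvdn_divisors// => dn /esym/eqP.
  by rewrite -(expn0 p) eqn_exp2l// => /eqP d0; rewrite d0 dvd0n gtn_eqF in dn.
have cards1 (a : F) : set_card (gen_subring1 a) \in s.
  have [k [kn -> _]] := gen_subring1P p_prime cardF a.
  by rewrite map_f// -dvdn_divisors.
have cards1P t : t \in s -> exists2 a : F, a != 0%R & set_card (gen_subring1 a) = t.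
  move=> /mapP[d]; rewrite -dvdn_divisors// => dn ->.
  exact: (gen_subring1_surj p_prime cardF).
split; rewrite -(size_map (expn p)).
  apply: compression_graph_iso => // [|t /cards1P[a _ <-]]; last by exists a.
  exact: (gen_subring1_inj p_prime cardF).
apply: (@compression_graph_iso _ _ (1%N :: s)) => [|a b|a|t].
- by rewrite /= s1.
- have [->|a0] := eqVneq a 0%R; have [->|b0] := eqVneq b 0%R => //.
  + rewrite set_card_gen_subring0 (gen_subring_neq0 b0) => b1.
    by have := cards1 b; rewrite -b1 (negPf s1).
  + rewrite set_card_gen_subring0 (gen_subring_neq0 a0) => a1.
    by have := cards1 a; rewrite a1 (negPf s1).
  + rewrite (gen_subring_neq0 a0) (gen_subring_neq0 b0).
    exact: (gen_subring1_inj p_prime cardF).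
- have [->|a0] := eqVneq a 0%R; first by rewrite set_card_gen_subring0 mem_head.
  by rewrite gen_subring_neq0// inE cards1 orbT.
- rewrite inE => /predU1P[->|]; first by exists 0%R; exact: set_card_gen_subring0.
  by move=> /cards1P[a a0 at_]; exists a; rewrite gen_subring_neq0.
Qed.
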